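(* Let $\{\rho_\theta : \theta=(\theta^1,\theta^2)\in\Theta\}$ be a two-parameter qubit model satisfying the regularity conditions, let $\theta\in\Theta$, and let $W$ be a $2\times 2$ real symmetric positive definite weight matrix. Then the Holevo bound is \[ C_\theta^H[W]= \begin{cases} C_\theta^R[W] & \text{if } C_\theta^R[W]\ge \tfrac{1}{2}\big(C_\theta^Z[W]+C_\theta^S[W]\big),\\[1ex] C_\theta^R[W]+S_\theta[W] & \text{otherwise}, \end{cases} \] where the nonnegative quantity $S_\theta[W]$ is \[ S_\theta[W]:=\frac{\Big[\tfrac{1}{2}\big(C_\theta^Z[W]+C_\theta^S[W]\big)-C_\theta^R[W]\Big]^2}{C_\theta^Z[W]-C_\theta^R[W]}. \]
   Context: A two-parameter qubit model is a family of density matrices $\rho_\theta$ on $\mathbb{C}^2$ indexed by $\theta=(\theta^1,\theta^2)$ in an open set $\Theta\subset\mathbb{R}^2$. Regularity conditions: each $\rho_\theta$ is strictly positive (full rank); $\theta\mapsto\rho_\theta$ is sufficiently smooth; the partial derivatives $\partial_1\rho_\theta,\partial_2\rho_\theta$ ($\partial_i=\partial/\partial\theta^i$) are linearly independent. The SLD operators $L_{\theta,i}$ are the hermitian solutions of $\partial_i\rho_\theta=\tfrac12(\rho_\theta L_{\theta,i}+L_{\theta,i}\rho_\theta)$; the RLD operators $\tilde L_{\theta,i}$ are defined by $\partial_i\rho_\theta=\rho_\theta\tilde L_{\theta,i}$. The SLD Fisher information matrix is $G_\theta=[g_{\theta,ij}]$ with $g_{\theta,ij}=\mathrm{tr}\big(\rho_\theta\tfrac12(L_{\theta,i}L_{\theta,j}+L_{\theta,j}L_{\theta,i})\big)$;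 the RLD Fisher information matrix is $\tilde G_\theta=[\tilde g_{\theta,ij}]$ with $\tilde g_{\theta,ij}=\mathrm{tr}(\rho_\theta\tilde L_{\theta,j}\tilde L_{\theta,i}^* )$. The SLD dual operators are $L_\theta^i=\sum_j (G_\theta^{-1})^{ji}L_{\theta,j}$, and $Z_\theta=[z_\theta^{ij}]_{i,j\in\{1,2\}}$ with $z_\theta^{ij}=\mathrm{tr}(\rho_\theta L_\theta^jL_\theta^i)$ (a hermitian matrix). $\mathrm{Re}\,\tilde G_\theta^{-1}$, $\mathrm{Im}\,\tilde G_\theta^{-1}$ denote the entrywise real/imaginary parts of the inverse matrix $\tilde G_\theta^{-1}$. For a diagonalizable matrix $X=T\,\mathrm{diag}(\lambda_1,\dots,\lambda_m)T^{-1}$, $\mathrm{TrAbs}\,X:=\sum_j|\lambda_j|$. The three bounds are $C_\theta^S[W]=\mathrm{Tr}(WG_\theta^{-1})$, $C_\theta^R[W]=\mathrm{Tr}(W\,\mathrm{Re}\,\tilde G_\theta^{-1})+\mathrm{TrAbs}(W\,\mathrm{Im}\,\tilde G_\theta^{-1})$, and $C_\theta^Z[W]=\mathrm{Tr}(W\,\mathrm{Re}\,Z_\theta)+\mathrm{TrAbs}(W\,\mathrm{Im}\,Z_\theta)$. The Holevo bound is $C_\theta^H[W]=\min_{\vec X\in\mathcal X_\theta}h_\theta[\vec X|W]$, where $\mathcal X_\theta$ is the set of pairs $\vec X=(X^1,X^2)$ of hermitian operators with $\mathrm{tr}(\rho_\theta X^i)=0$ and $\mathrm{tr}(\partial_i\rho_\theta\,X^j)=\delta^j_i$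 for all $i,j$, and $h_\theta[\vec X|W]=\mathrm{Tr}(W\,\mathrm{Re}\,Z_\theta[\vec X])+\mathrm{TrAbs}(W\,\mathrm{Im}\,Z_\theta[\vec X])$ with $Z_\theta[\vec X]=[\mathrm{tr}(\rho_\theta X^jX^i)]_{i,j}$. *)

(* Defs.v *)
From HB Require Import structures.
From mathcomp Require Import all_boot all_order all_algebra.
From mathcomp Require Import all_classical all_reals all_analysis.
From mathcomp.real_closed Require Import complex.

Set Implicit Arguments.
Unset Strict Implicit.
Unset Printing Implicit Defensive.

Import Order.TTheory GRing.Theory Num.Theory.
Import numFieldNormedType.Exports.
Local Open Scope ring_scope.

Section QubitDefs.
Variable R : realType.
Local Notation C := (R[i]).

Definition adj {m n : nat} (A : 'M[C]_(m, n)) : 'M[C]_(n, m) :=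
  (map_mx (@conjc R) A)^T.

Definition hermitian {n : nat} (A : 'M[C]_n) : Prop := adj A = A.

Definition posdef {n : nat} (A : 'M[C]_n) : Prop :=
  hermitian A /\ forall v : 'cV[C]_n, v != 0 -> 0 < (adj v *m A *m v) 0 0.

Definition strictly_positive_density {n : nat} (A : 'M[C]_n) : Prop :=
  posdef A /\ \tr A = 1.

Definition cmx {m n : nat} (A : 'M[R]_(m, n)) : 'M[C]_(m, n) :=
  map_mx (fun x : R => x%:C%C) A.

Definition Re_mx {m n : nat} (A : 'M[C]_(m, n)) : 'M[R]_(m, n) := map_mx (@complex.Re R) A.
Definition Im_mx {m n : nat} (A : 'M[C]_(m, n)) : 'M[R]_(m, n) := map_mx (@complex.Im R) A.

(** the eigenvalues (with algebraic multiplicity) of a real square matrix,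
    as the complex roots of its characteristic polynomial *)
Definition eigenvalues {n : nat} (X : 'M[R]_n) : seq C :=
  sval (closed_field_poly_normal (char_poly (cmx X))).

Definition TrAbs {n : nat} (X : 'M[R]_n) : R :=
  \sum_(z <- eigenvalues X) Normc.normc z.

Definition bound2 (W : 'M[R]_2) (Z : 'M[C]_2) : R :=
  \tr (W *m Re_mx Z) + TrAbs (W *m Im_mx Z).

Definition Zmat (rho : 'M[C]_2) (X : 'I_2 -> 'M[C]_2) : 'M[C]_2 :=
  \matrix_(i < 2, j < 2) \tr (rho *m X j *m X i).

Definition partial_mx (rho : R * R -> 'M[C]_2) (t v : R * R) : 'M[C]_2 :=
  \matrix_(j < 2, k < 2)
     ((derive (fun s => complex.Re (rho s j k)) t v) +i* (derive (fun s => complex.Im (rho s j k)) t v))%C.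

Definition coord_dir (i : 'I_2) : R * R := if i == ord0 then (1, 0) else (0, 1).

Definition drho (rho : R * R -> 'M[C]_2) (t : R * R) (i : 'I_2) : 'M[C]_2 :=
  partial_mx rho t (coord_dir i).

Definition is_SLD (rho D L : 'M[C]_2) : Prop :=
  hermitian L /\ D = 2^-1 *: (rho *m L + L *m rho).

Definition is_RLD (rho D Lt : 'M[C]_2) : Prop := D = rho *m Lt.

Definition SLD_Fisher (rho : 'M[C]_2) (L : 'I_2 -> 'M[C]_2) : 'M[C]_2 :=
  \matrix_(i < 2, j < 2) \tr (rho *m (2^-1 *: (L i *m L j + L j *m L i))).

Definition RLD_Fisher (rho : 'M[C]_2) (Lt : 'I_2 -> 'M[C]_2) : 'M[C]_2 :=
  \matrix_(i < 2, j < 2) \tr (rho *m Lt j *m adj (Lt i)).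

Definition SLD_dual (rho : 'M[C]_2) (L : 'I_2 -> 'M[C]_2) (i : 'I_2) : 'M[C]_2 :=
  \sum_(j < 2) (invmx (SLD_Fisher rho L)) j i *: L j.

Definition CS (W : 'M[R]_2) (rho : 'M[C]_2) (L : 'I_2 -> 'M[C]_2) : R :=
  complex.Re (\tr (cmx W *m invmx (SLD_Fisher rho L))).
Definition CR (W : 'M[R]_2) (rho : 'M[C]_2) (Lt : 'I_2 -> 'M[C]_2) : R :=
  bound2 W (invmx (RLD_Fisher rho Lt)).
Definition CZ (W : 'M[R]_2) (rho : 'M[C]_2) (L : 'I_2 -> 'M[C]_2) : R :=
  bound2 W (Zmat rho (SLD_dual rho L)).

Definition holevo_feasible (rho : 'M[C]_2) (D : 'I_2 -> 'M[C]_2)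
    (X : 'I_2 -> 'M[C]_2) : Prop :=
  (forall i, hermitian (X i)) /\
  (forall i, \tr (rho *m X i) = 0) /\
  (forall i j, \tr (D i *m X j) = (i == j)%:R).

Definition holevo_fun (W : 'M[R]_2) (rho : 'M[C]_2) (X : 'I_2 -> 'M[C]_2) : R :=
  bound2 W (Zmat rho X).

Definition is_holevo_bound (W : 'M[R]_2) (rho : 'M[C]_2) (D : 'I_2 -> 'M[C]_2)
    (c : R) : Prop :=
  (exists X, holevo_feasible rho D X /\ holevo_fun W rho X = c) /\
  (forall X, holevo_feasible rho D X -> c <= holevo_fun W rho X).

Definition weight_matrix (W : 'M[R]_2) : Prop :=
  W^T = W /\ forall v : 'cV[R]_2, v != 0 -> 0 < (v^T *m W *m v) 0 0.

End QubitDefs.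

(* Main.v *)
Require Import Defs.
From HB Require Import structures.
From mathcomp Require Import all_boot all_order all_algebra.
From mathcomp Require Import all_classical all_reals all_analysis.
From mathcomp.real_closed Require Import complex.
From mathcomp Require Import ring lra.
Import Order.TTheory GRing.Theory Num.Theory.
Import numFieldNormedType.Exports.
Local Open Scope ring_scope.
Local Open Scope classical_set_scope.

(* In Bloch coordinates rho = (1 + r.sigma)/2 and d_i rho = (d_i.sigma)/2, an
   admissible X^j is determined by its Bloch vector x_j, subject to
   d_i . x_j = delta_ij.  Hence x_j is free only along n = d_1 x d_2, with
   coordinate T_j = x_j . M n, where M = 1 - r r^T is the SLD covariance form;
   T = 0 is the SLD dual.  Since TrAbs (W z J) = 2 |z| sqrt (det W) for the
   rotation J, the Holevo function becomes
     C^S + (T^T W T) / c + 2 sqrt (det W) |a - (r.d_1 T_1 + r.d_2 T_2) / c|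
   with c = n . M n and a constant a: a quadratic plus the absolute value of an affine function.
   Its minimum has two regimes, according to whether the kink is reached, and the
   RLD bound is exactly the value of the regime where it is not. *)

Set Implicit Arguments.
Unset Strict Implicit.

(** * Vector algebra in three dimensions and the dual basis of [d1], [d2], [q] *)

Section RealVectors.
Variable R : realType.
Implicit Types u v w x y z r a b q n : R * R * R.

Definition dot u v : R := u.1.1 * v.1.1 + u.1.2 * v.1.2 + u.2 * v.2.

Definition cross u v : R * R * R :=
  (u.1.2 * v.2 - u.2 * v.1.2, u.2 * v.1.1 - u.1.1 * v.2,
   u.1.1 * v.1.2 - u.1.2 * v.1.1).

Definition lincomb k u l v : R * R * R :=
  (k * u.1.1 + l * v.1.1, k * u.1.2 + l * v.1.2, k * u.2 + l * v.2).

Lemma dotC u v : dot u v = dot v u.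
Proof. rewrite /dot; ring. Qed.

Lemma dot_lincomb k u l v w :
  dot (lincomb k u l v) w = k * dot u w + l * dot v w.
Proof. by rewrite /dot /=; ring. Qed.

Lemma dot_ge0 u : 0 <= dot u u.
Proof. by rewrite /dot -!expr2 !addr_ge0 ?sqr_ge0. Qed.

Lemma dot_eq0 u : dot u u = 0 -> u = (0, 0, 0).
Proof.
case: u => [[u1 u2] u3]; rewrite /dot /= => h.
by congr (_, _, _); nra.
Qed.

Lemma lagrange u v x y :
  dot (cross u v) (cross x y) = dot u x * dot v y - dot u y * dot v x.
Proof. rewrite /dot /cross /=; ring. Qed.

Lemma dot_crossl u v : dot u (cross u v) = 0.
Proof. rewrite /dot /cross /=; ring. Qed.

Lemma dot_crossr u v : dot v (cross u v) = 0.
Proof. rewrite /dot /cross /=; ring. Qed.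

Lemma dot_cross_rot u v w : dot u (cross v w) = dot v (cross w u).
Proof. rewrite /dot /cross /=; ring. Qed.

(** Up to the triple product, [cross b q], [cross q a], [cross a b] form the basis dual to [a], [b],
    [q]; the identity expands x in that dual basis, without division. *)
Lemma cramer a b q x y :
  dot (cross a b) q * dot x y =
  dot x a * dot y (cross b q) + dot x b * dot y (cross q a)
  + dot x q * dot y (cross a b).
Proof. rewrite /dot /cross /=; ring. Qed.

(** Expand x and y as in [cramer]: cross products of the dual vectors are again multiples of [a],
    [b], [q]. *)
Lemma cramer_cross a b q x y z :
  dot (cross a b) q * dot z (cross x y) =
  (dot x a * dot y b - dot x b * dot y a) * dot z q
  + (dot x b * dot y q - dot x q * dot y b) * dot z a
  + (dot x q * dot y a - dot x a * dot y q) * dot z b.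
Proof. rewrite /dot /cross /=; ring. Qed.

(* Covariance of the centred observables with Bloch vectors x, y in the state
   with Bloch vector r; its matrix is 1 - r r^T. *)
Definition cov r x y : R := dot x y - dot r x * dot r y.
Definition cov_vec r x : R * R * R := lincomb 1 x (- dot r x) r.

Lemma covC r x y : cov r x y = cov r y x.
Proof. by rewrite /cov dotC [_ * _]mulrC. Qed.

Lemma dot_cov_vec r x y : dot x (cov_vec r y) = cov r x y.
Proof. by rewrite /cov_vec dotC dot_lincomb /cov (dotC y); ring. Qed.

(** For the symmetric M = 1 - r r^T one has M (M u x M v) = det M (u x v), with det M = 1 - r.r.
    Take u = M^-1 b and v = n; the second term comes from M^-1 b = b + (r.b) r / det M. *)
Lemma cov_cross r y b n :
  cov r y (cross b (cov_vec r n)) =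
  (1 - dot r r) * dot y (cross b n) + dot r b * dot y (cross r n).
Proof. rewrite /cov /cov_vec /dot /cross /=. ring. Qed.

Section Dual.
Variables r d1 d2 : R * R * R.
Let n := cross d1 d2.
Let q := cov_vec r n.
Let c := dot n q.
Let e := 1 - dot r r.

(** Apply [cramer] to x . M y in the basis [d1], [d2], [q], whose triple product is [c]. No mixed
    term with [q] = M n survives, because n is orthogonal to [d1] and [d2]. *)
Lemma cov_dual x y :
  c * cov r x y =
  (e * dot d2 d2 + dot r d2 ^+ 2) * (dot x d1 * dot y d1)
  - (e * dot d1 d2 + dot r d1 * dot r d2) *
    (dot x d1 * dot y d2 + dot x d2 * dot y d1)
  + (e * dot d1 d1 + dot r d1 ^+ 2) * (dot x d2 * dot y d2)
  + dot x q * dot y q.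
Proof.
have dm u v w : dot y (cross w (cross u v)) = dot y u * dot w v - dot y v * dot w u.
  rewrite /dot /cross /=; ring.
rewrite -(dot_cov_vec r x y) /c (cramer d1 d2 q x (cov_vec r y)).
rewrite !(dotC (cov_vec r y)) !dot_cov_vec.
rewrite !(covC r _ y) [cov r y (cross d2 q)]cov_cross.
have -> : cov r y (cross q d1) = - cov r y (cross d1 q).
  rewrite /cov /dot /cross /=; ring.
rewrite [cov r y (cross d1 q)]cov_cross -(dot_cov_vec r y n) -/q /n !dm /e.
rewrite (dotC d2 d1); ring.
Qed.

(** Instance of [cramer_cross] with r . q = e (r . n). It makes the imaginary part of tr(rho X Y)
    affine in the two free coordinates. *)
Lemma cross_dual x y :
  dot x d1 = 1 -> dot x d2 = 0 -> dot y d1 = 0 -> dot y d2 = 1 ->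
  c * dot r (cross x y) =
  e * dot r n - dot x q * dot r d1 - dot y q * dot r d2.
Proof.
move=> x1 x2 y1 y2; rewrite /c cramer_cross x1 x2 y1 y2 dot_cov_vec /cov.
by rewrite /e; ring.
Qed.

Lemma dual_norm :
  c = dot d1 d1 * dot d2 d2 - dot d1 d2 ^+ 2 - dot r n ^+ 2.
Proof. by rewrite /c dot_cov_vec /cov lagrange (dotC d2); ring. Qed.

(** The left side is e^2 times the Gram determinant of [d1], [d2] for M^-1 = 1 + r r^T / e, and that
    determinant is n . M n / det M = c / e. *)
Lemma dual_gram :
  (e * dot d1 d1 + dot r d1 ^+ 2) * (e * dot d2 d2 + dot r d2 ^+ 2)
   - (e * dot d1 d2 + dot r d1 * dot r d2) ^+ 2 = e * c.
Proof. rewrite dual_norm /e /n /dot /cross /=; ring. Qed.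

Lemma dual_norm_gt0 : 0 < e -> (dot n n != 0) -> 0 < c.
Proof.
move=> e0 n0.
have h : c = e * dot n n + dot (cross r n) (cross r n).
  by rewrite lagrange /c dot_cov_vec /cov /e (dotC n r); ring.
by rewrite h ltr_wpDr ?dot_ge0 // mulr_gt0 // lt_def n0 dot_ge0.
Qed.

Hypothesis c_gt0 : 0 < c.

Lemma dual_exists T1 T2 : exists x y,
  [/\ dot x d1 = 1, dot x d2 = 0 & dot x q = T1] /\
  [/\ dot y d1 = 0, dot y d2 = 1 & dot y q = T2].
Proof.
have c0 : c != 0 by rewrite gt_eqF.
have h1 : dot n d1 = 0 by rewrite dotC dot_crossl.
have h2 : dot n d2 = 0 by rewrite dotC dot_crossr.
have k1 : dot (cross d2 q) d1 = c by rewrite dotC dot_cross_rot dot_cross_rot dotC.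
have k2 : dot (cross q d1) d2 = c by rewrite dotC dot_cross_rot dotC.
have k3 : dot (cross d2 q) d2 = 0 by rewrite dotC dot_crossl.
have k4 : dot (cross q d1) d1 = 0 by rewrite dotC dot_crossr.
have k5 : dot (cross d2 q) q = 0 by rewrite dotC dot_crossr.
have k6 : dot (cross q d1) q = 0 by rewrite dotC dot_crossl.
(* The first summands are the dual vectors, orthogonal to [q]. Adding a multiple of [n] leaves the
   pairings with [d1], [d2] unchanged and sets the one with [q], as n . q = c. *)
exists (lincomb c^-1 (cross d2 q) (T1 / c) n).
exists (lincomb c^-1 (cross q d1) (T2 / c) n).
rewrite !dot_lincomb h1 h2 k1 k2 k3 k4 k5 k6 -/c.
by rewrite !mulr0 !addr0 !add0r mulVf // !mulfVK.
Qed.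

End Dual.
End RealVectors.

(** * Minimum of a quadratic form plus the absolute value of an affine function *)

Section Minimisation.
Variable R : realType.
Variables w11 w12 w22 w r1 r2 c a : R.
Hypotheses (w11_gt0 : 0 < w11) (w_gt0 : 0 < w) (c_gt0 : 0 < c).
Hypothesis w_sqr : w ^+ 2 = w11 * w22 - w12 ^+ 2.

Definition wform x y := w11 * x ^+ 2 + 2 * w12 * (x * y) + w22 * y ^+ 2.

Definition penalty x y :=
  (wform x y) / c + 2 * w * `|a - (x * r1 + y * r2) / c|.

(** With r = (r1, r2) this is r^T adj(W) r, the dual form of W scaled by w^2 = det W. *)
Let K := wform r2 (- r1).

Lemma wform_ge0 x y : 0 <= wform x y.
Proof.
have h : w11 * wform x y = (w11 * x + w12 * y) ^+ 2 + w ^+ 2 * y ^+ 2.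
  by rewrite w_sqr /wform; ring.
by rewrite -(pmulr_rge0 _ w11_gt0) h -exprMn addr_ge0 ?sqr_ge0.
Qed.

Lemma wform_cauchy x y : w ^+ 2 * (x * r1 + y * r2) ^+ 2 <= K * wform x y.
Proof.
rewrite -subr_ge0.
have -> : K * wform x y - w ^+ 2 * (x * r1 + y * r2) ^+ 2 =
  (w11 * x * r2 + w12 * (y * r2 - x * r1) - w22 * y * r1) ^+ 2.
  by rewrite w_sqr /K /wform; ring.
exact: sqr_ge0.
Qed.

Let u := w * `|a|.
Let k := K / c.

(** The triangle inequality loses at most 2 w |s| / c from 2 u, and the Cauchy inequality with AM-GM
    bounds 2 w |s| by P + K. *)
Lemma penalty_ge_small x y : 2 * u - k <= penalty x y.
Proof.
rewrite /penalty /u /k; set s := x * r1 + y * r2.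
have hc := wform_cauchy x y; rewrite -/s in hc.
have h0 := wform_ge0 x y; have hK : 0 <= K by exact: wform_ge0.
set P := wform x y in hc h0 *.
have amgm : 2 * (w * `|s|) <= P + K.
  have l0 : 0 <= 2 * (w * `|s|) by rewrite !mulr_ge0 // ltW.
  have r0 : 0 <= P + K by exact: addr_ge0.
  rewrite -(@ler_pXn2r _ 2) ?nnegrE // !exprMn real_normK ?num_real //.
  have -> : (P + K) ^+ 2 = 2 ^+ 2 * (K * P) + (P - K) ^+ 2 by ring.
  by apply: ler_wpDr; rewrite ?sqr_ge0 // ler_pM2l // exprn_gt0.
have tri : `|a| - `|s / c| <= `|a - s / c| by exact: lerB_dist.
have ns : `|s / c| = `|s| / c by rewrite normrM normfV (gtr0_norm c_gt0).
rewrite ns in tri.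
have := ler_pM2l w_gt0 (`|a| - `|s| / c) `|a - s / c|; rewrite tri => tri'.
have := ler_pM2r (_ : 0 < c^-1) (2 * (w * `|s|)) (P + K).
rewrite invr_gt0 => /(_ c_gt0); rewrite amgm => amgm'.
rewrite mulrBr in tri'; lra.
Qed.

Lemma penalty_small : k <= u ->
  exists x y, penalty x y = 2 * u - k.
Proof.
move=> ku.
have [s [s2 sa]] : exists s : R, s * s = 1 /\ a = s * `|a|.
  have [a0|a0] := leP 0 a; [exists 1|exists (- 1)].
    by rewrite ger0_norm // !mul1r.
  by rewrite ltr0_norm // mulrNN mulr1 mulrN mulNr mul1r opprK.
have w0 : w != 0 by rewrite gt_eqF.
have c0 : c != 0 by rewrite gt_eqF.
(* The direction adj(W) r gives equality in Cauchy, the factor 1 / w gives P = K and hence equality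
   in AM-GM, and the sign [s] of [a] moves towards the kink; k <= u says that the kink is not
   passed. *)
exists (s / w * (w22 * r1 - w12 * r2)), (s / w * (w11 * r2 - w12 * r1)).
have e1 : wform (s / w * (w22 * r1 - w12 * r2)) (s / w * (w11 * r2 - w12 * r1)) = K.
  have -> : wform (s / w * (w22 * r1 - w12 * r2)) (s / w * (w11 * r2 - w12 * r1))
      = (s * s) / w ^+ 2 * ((w11 * w22 - w12 ^+ 2) * K).
    by rewrite /K /wform; field.
  by rewrite s2 -w_sqr; field.
rewrite /penalty e1.
have -> : s / w * (w22 * r1 - w12 * r2) * r1 + s / w * (w11 * r2 - w12 * r1) * r2
   = s / w * K by rewrite /K /wform; field.
have -> : a - s / w * K / c = s / w * (u - k).
  by rewrite {1}sa /u /k; field; rewrite w0 c0.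
have ns : `|s| = 1.
  by apply/eqP; rewrite -(@pexpr_eq1 _ _ 2) // real_normK ?num_real // expr2 s2.
rewrite !normrM normfV ns (gtr0_norm w_gt0) ger0_norm ?subr_ge0 //.
by rewrite -/k /u; field.
Qed.

Lemma penalty_ge_large x y : u < k -> u ^+ 2 / k <= penalty x y.
Proof.
move=> uk.
have u0 : 0 <= u by rewrite mulr_ge0 // ltW.
have k0 : 0 < k by exact: le_lt_trans uk.
rewrite /penalty; set s := x * r1 + y * r2.
have hc := wform_cauchy x y; rewrite -/s in hc.
set P := wform x y in hc *.
pose p := w * `|s / c|.
have hp : p ^+ 2 / k <= P / c.
  rewrite ler_pdivrMr //.
  have -> : p ^+ 2 = (w ^+ 2 * s ^+ 2) / c ^+ 2.
    by rewrite /p exprMn real_normK ?num_real // exprMn exprVn mulrA.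
  have -> : P / c * k = (K * P) / c ^+ 2.
    by rewrite /k; field; rewrite gt_eqF.
  by rewrite ler_pM2r // invr_gt0 exprn_gt0.
have p0 : 0 <= p by rewrite mulr_ge0 // ltW.
have tri : u - p <= w * `|a - s / c|.
  by rewrite -mulrBr ler_pM2l // lerB_dist.
have t0 : 0 <= w * `|a - s / c| by rewrite mulr_ge0 // ltW.
rewrite -mulrA; set t := w * _ in tri t0 *.
apply: (le_trans _ (lerD hp (lexx (2 * t)))).
rewrite -subr_ge0.
have -> : p ^+ 2 / k + 2 * t - u ^+ 2 / k = (2 * t * k - (u ^+ 2 - p ^+ 2)) / k.
  by field; rewrite gt_eqF.
rewrite divr_ge0 ?(ltW k0) // subr_ge0.
(* If u <= p then u^2 - p^2 is nonpositive. Otherwise t >= u - p and u + p <= 2 k, so 2 t k >= (u -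
   p) (u + p). *)
have [up|pu] := leP u p; nra.
Qed.

Lemma penalty_large : u < k -> exists x y, penalty x y = u ^+ 2 / k.
Proof.
move=> uk.
have u0 : 0 <= u by rewrite mulr_ge0 // ltW.
have k0 : 0 < k by exact: le_lt_trans uk.
have K0 : K != 0 by apply: contraTneq k0; rewrite /k => ->; rewrite mul0r ltxx.
have c0 : c != 0 by rewrite gt_eqF.
(* Same direction adj(W) r, now scaled to lie exactly on the kink, x r1 + y r2 = a c. *)
exists (a * c / K * (w22 * r1 - w12 * r2)), (a * c / K * (w11 * r2 - w12 * r1)).
set x := _ * (w22 * _ - _); set y := _ * (w11 * _ - _).
have e1 : wform x y = (a * c) ^+ 2 * w ^+ 2 / K.
  have -> : wform x y = (a * c / K) ^+ 2 * ((w11 * w22 - w12 ^+ 2) * K).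
    by rewrite /x /y {4}/K /wform; ring.
  by rewrite -w_sqr; field.
have e2 : x * r1 + y * r2 = a * c.
  have -> : x * r1 + y * r2 = a * c / K * K.
    by rewrite /x /y {4}/K /wform; ring.
  by rewrite mulfVK.
rewrite /penalty e1 e2 mulfK // subrr normr0 mulr0 addr0.
have -> : u ^+ 2 = w ^+ 2 * a ^+ 2 by rewrite /u exprMn real_normK ?num_real.
by rewrite /k; field; rewrite c0.
Qed.


(** Shaped like the theorem: relative to C^S, [2 * u] stands for C^Z and [2 * u - k] for C^R. The
    second branch simplifies to u^2 / k. *)
Definition penalty_min : R :=
  if 2^-1 * (2 * u) <= 2 * u - k then 2 * u - k
  else 2 * u - k + (2^-1 * (2 * u) - (2 * u - k)) ^+ 2 / k.

Lemma penalty_minP :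
  (exists x y, penalty x y = penalty_min) /\ (forall x y, penalty_min <= penalty x y).
Proof.
rewrite /penalty_min mulKf ?pnatr_eq0 //.
have -> : (u <= 2 * u - k) = (k <= u) by apply/idP/idP; lra.
have u0 : 0 <= u by rewrite mulr_ge0 // ltW.
have [ku|uk] := leP k u.
  by split; [exact: penalty_small|exact: penalty_ge_small].
have k0 : k != 0 by rewrite gt_eqF // (le_lt_trans u0).
have -> : 2 * u - k + (u - (2 * u - k)) ^+ 2 / k = u ^+ 2 / k by field.
split; [exact: penalty_large|by move=> x y; exact: penalty_ge_large].
Qed.

End Minimisation.

(** * Entrywise formulas for 2 x 2 matrices *)

Section TwoByTwo.
Variable K : fieldType.
Implicit Types A B : 'M[K]_2.

Lemma sum2 (V : nmodType) (F : 'I_2 -> V) : \sum_i F i = F 0 + F 1.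
Proof.
by rewrite !big_ord_recl big_ord0 addr0; congr (_ + F _); apply: val_inj.
Qed.

Lemma ord2P (P : 'I_2 -> Prop) : P 0 -> P 1 -> forall i, P i.
Proof.
move=> P0 P1 [[|[|//]] i]; [move: P0|move: P1]; congr P; exact: val_inj.
Qed.

Lemma eq_mx2 A B : A 0 0 = B 0 0 -> A 0 1 = B 0 1 ->
  A 1 0 = B 1 0 -> A 1 1 = B 1 1 -> A = B.
Proof.
by move=> *; apply/matrixP; elim/ord2P; elim/ord2P.
Qed.

Lemma mulmx2 A B i j : (A *m B) i j = A i 0 * B 0 j + A i 1 * B 1 j.
Proof. by rewrite !mxE sum2. Qed.

Lemma mxtrace2 A : \tr A = A 0 0 + A 1 1.
Proof. by rewrite /mxtrace sum2. Qed.

Lemma det2 A : \det A = A 0 0 * A 1 1 - A 0 1 * A 1 0.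
Proof.
have l0 : lift (0 : 'I_2) (0 : 'I_1) = 1 by exact: val_inj.
have l1 : lift (1 : 'I_2) (0 : 'I_1) = 0 by exact: val_inj.
rewrite (expand_det_row _ 0) sum2 /cofactor !det_mx11 !mxE /= l0 l1.
by rewrite expr0 mul1r expr1 mulN1r mulrN.
Qed.

Lemma invmx_eq n (A B : 'M[K]_n) : A *m B = 1%:M -> invmx A = B.
Proof.
move=> AB; have [uA _] := mulmx1_unit AB.
by rewrite -[LHS]mulmx1 -AB mulKmx.
Qed.

Lemma char_poly_split2 A (a b : K) :
  char_poly A = ('X - a%:P) * ('X - b%:P) -> a + b = \tr A /\ a * b = \det A.
Proof.
move=> h.
have e : char_poly A = 'X^2 - (a + b) *: 'X + (a * b)%:P.
  by rewrite h -mul_polyC polyCD polyCM; ring.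
have := char_poly_trace A isT; have := char_poly_det A; rewrite e /=.
rewrite sqrrN expr1n mul1r => <- htr; move: htr; rewrite !coefE /=.
by rewrite mulr1 mulr0 subrr !add0r addr0 => /oppr_inj.
Qed.

End TwoByTwo.

(** * Evaluation of [TrAbs] and the Bloch representation of hermitian matrices *)

Section Bounds.
Local Open Scope complex_scope.
Variable R : realType.
Local Notation C := R[i].

(** Trace zero makes the eigenvalues opposite, and determinant s^2 makes their square -s^2, so they
    are i s and -i s. *)
Lemma TrAbs_traceless (X : 'M[R]_2) (s : R) :
  \tr X = 0 -> 0 <= s -> \det X = s ^+ 2 -> TrAbs X = 2 * s.
Proof.
move=> trX s0 detX; rewrite /TrAbs /eigenvalues.
case: closed_field_poly_normal => e /= he.
move: he; rewrite (monicP (char_poly_monic _)) scale1r => he.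
have := size_char_poly (cmx X); rewrite he size_prod_XsubC => -[].
case: e he => [|a [|b [|//]]] // he _.
move: he; rewrite !big_cons !big_nil addr0 mulr1 => /char_poly_split2[].
have -> : \tr (cmx X) = 0.
  by rewrite mxtrace2 !mxE -rmorphD /= -mxtrace2 trX.
have -> : \det (cmx X) = (s ^+ 2)%:C by rewrite det_map_mx detX.
move=> /eqP; rewrite addr_eq0 => /eqP -> {a}.
have -> : Normc.normc (- b) = Normc.normc b by case: b => x y /=; rewrite !sqrrN.
case: b => [x y] /eqP; rewrite eq_complex; simpc => /andP[/eqP /= h1 /eqP /= h2].
suff -> : Num.sqrt (x ^+ 2 + y ^+ 2) = s by ring.
have [x0|/eqP x0] := eqVneq x 0.
  rewrite x0 expr0n add0r; move: h1; rewrite x0 => h1.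
  have -> : y ^+ 2 = s ^+ 2 by rewrite -h1; ring.
  by rewrite sqrtr_sqr ger0_norm.
have y0 : y = 0 by apply: (mulfI (_ : x != 0)); [exact/eqP|lra].
have : s ^+ 2 + x ^+ 2 = 0 by rewrite -h1 y0; ring.
by move=> /eqP; rewrite paddr_eq0 ?sqr_ge0 // => /andP[_]; rewrite sqrf_eq0 => /eqP/x0.
Qed.

(** For hermitian Z the matrix Im Z is antisymmetric, so W Im Z is traceless with determinant det W
    (Im Z01)^2, and [TrAbs_traceless] applies. *)
Lemma bound2E (W : 'M[R]_2) (Z : 'M[C]_2) (w : R) :
  W^T = W -> 0 <= w -> w ^+ 2 = \det W -> adj Z = Z ->
  bound2 W Z = W 0 0 * complex.Re (Z 0 0) + 2 * W 0 1 * complex.Re (Z 0 1)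
    + W 1 1 * complex.Re (Z 1 1) + 2 * w * `|complex.Im (Z 0 1)|.
Proof.
move=> /matrixP WT w0 wdet /matrixP ZT.
have W10 : W 1 0 = W 0 1 by rewrite -WT mxE.
have hZ i j : Z j i = conjc (Z i j) by rewrite -[LHS]ZT !mxE.
have imd i : complex.Im (Z i i) = 0.
  by have := hZ i i; case: (Z i i) => x y [] /=; lra.
have h10 : Z 1 0 = conjc (Z 0 1) by exact: hZ.
rewrite /bound2 (@TrAbs_traceless _ (w * `|complex.Im (Z 0 1)|)).
- rewrite mxtrace2 !mulmx2 !mxE h10 W10; case: (Z 0 1) => x y /=; ring.
- rewrite mxtrace2 !mulmx2 !mxE !imd h10 W10; case: (Z 0 1) => x y /=; ring.
- by rewrite mulr_ge0.
rewrite det_mulmx -wdet exprMn real_normK ?num_real // det2 !mxE !imd h10.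
by case: (Z 0 1) => x y /=; ring.
Qed.

Lemma weight_matrix_pos (W : 'M[R]_2) : weight_matrix W ->
  0 < W 0 0 /\ 0 < \det W.
Proof.
move=> [/matrixP WT Wpos].
have W10 : W 1 0 = W 0 1 by rewrite -WT mxE.
have pos (x y : R) : (x != 0) || (y != 0) ->
    0 < W 0 0 * x ^+ 2 + 2 * W 0 1 * (x * y) + W 1 1 * y ^+ 2.
  move=> xy; pose v : 'cV[R]_2 := \col_i (if i == 0 then x else y).
  have v0 : v != 0.
    apply: contraL xy => /eqP /matrixP h.
    by have := h 0 0; have := h 1 0; rewrite !mxE /= => -> ->; rewrite eqxx.
  have := Wpos v v0; rewrite -mulmxA !mxE sum2 !mxE !sum2 !mxE /= W10.
  by congr (0 < _); ring.
have p0 : 0 < W 0 0.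
  have := pos 1 0; rewrite oner_eq0 => /(_ isT).
  by rewrite expr1n expr0n !mulr0 !addr0 mulr1.
(* At this vector the form equals W00 det W. *)
split=> //; have := pos (- W 0 1) (W 0 0); rewrite (gt_eqF p0) orbT => /(_ isT).
move=> h.
rewrite -(pmulr_rgt0 _ p0) det2 W10; apply: (lt_le_trans h).
by rewrite le_eqVlt; apply/orP; left; apply/eqP; ring.
Qed.

(** This is s 1 + v . sigma for the Pauli matrices sigma; the factor 1/2 of states and their
    derivatives is kept outside. *)
Definition bloch (s : R) (v : R * R * R) : 'M[C]_2 :=
  \matrix_(i, j)
    if i == 0 then (if j == 0 then (s + v.2)%:C else v.1.1 -i* v.1.2)
    else (if j == 0 then v.1.1 +i* v.1.2 else (s - v.2)%:C).

Lemma bloch_inj s v t u : bloch s v = bloch t u -> s = t /\ v = u.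
Proof.
move=> /matrixP h; have := h 0 0; have := h 1 0; have := h 1 1.
case: v u {h} => [[v1 v2] v3] [[u1 u2] u3].
rewrite !mxE /= => -[h1] [h2 h3] [h4].
by split; [lra|congr (_, _, _); lra].
Qed.

Lemma adj_bloch s v : adj (bloch s v) = bloch s v.
Proof.
by apply: eq_mx2; rewrite !mxE /= ?oppr0 ?opprK.
Qed.

Lemma hermitian_bloch (A : 'M[C]_2) : Defs.hermitian A -> exists s v, A = bloch s v.
Proof.
move=> /matrixP h.
have hA i j : A j i = conjc (A i j) by rewrite -[LHS]h !mxE.
exists (2^-1 * (complex.Re (A 0 0) + complex.Re (A 1 1))).
exists (complex.Re (A 0 1), - complex.Im (A 0 1),
        2^-1 * (complex.Re (A 0 0) - complex.Re (A 1 1))).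
have h00 := hA 0 0; have h11 := hA 1 1.
apply: eq_mx2; rewrite !mxE /=.
- by case: (A 0 0) h00 => x y [] /= ?; congr (_ +i* _); lra.
- by case: (A 0 1) => x y /=; rewrite opprK.
- by rewrite (hA 0 1); case: (A 0 1).
- by case: (A 1 1) h11 => x y [] /= ?; congr (_ +i* _); lra.
Qed.

Lemma scale_bloch k s v :
  k%:C *: bloch s v = bloch (k * s) (k * v.1.1, k * v.1.2, k * v.2).
Proof.
apply: eq_mx2; rewrite !mxE /=; simpc; congr (_ +i* _); ring.
Qed.

End Bounds.

(** * Traces of products in Bloch coordinates *)

Section Qubit.
Local Open Scope complex_scope.
Variable R : realType.
Local Notation C := R[i].
Local Notation vec := (R * R * R)%type.
Implicit Types (u v w x y z : vec) (s t : R).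

Lemma hermitian_half_bloch (A : 'M[C]_2) :
  Defs.hermitian A -> exists s v, A = 2^-1 *: bloch s v.
Proof.
move=> hA; have h2 : Defs.hermitian (2 *: A).
  rewrite /Defs.hermitian -[in RHS]hA; apply/matrixP => i j.
  by rewrite !mxE rmorphM rmorph_nat.
have [s [v e]] := hermitian_bloch h2.
by exists s, v; rewrite -e scalerA mulVf ?pnatr_eq0 // scale1r.
Qed.

Lemma adjoint_mul (A B : 'M[C]_2) : adj (A *m B) = adj B *m adj A.
Proof. by rewrite /adj map_mxM trmx_mul. Qed.

Lemma adjoint_scale (k : R) (A : 'M[C]_2) : adj (k%:C *: A) = k%:C *: adj A.
Proof.
by apply/matrixP => i j; rewrite !mxE rmorphM /=; congr (_ * _); rewrite /= oppr0.
Qed.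

Lemma half_real : 2^-1 = (2^-1)%:C :> C.
Proof. by rewrite fmorphV rmorph_nat. Qed.

Lemma half_blochE s v : 2^-1 *: bloch s v =
  bloch (2^-1 * s) (2^-1 * v.1.1, 2^-1 * v.1.2, 2^-1 * v.2).
Proof. by rewrite half_real scale_bloch. Qed.

Lemma tr_half_bloch s v : \tr (2^-1 *: bloch s v) = s%:C.
Proof.
by rewrite half_blochE mxtrace2 !mxE /=; simpc; congr (_ +i* _); field.
Qed.

Lemma tr_bloch2 s v t w :
  \tr ((2^-1 *: bloch s v) *m bloch t w) = (s * t + dot v w)%:C.
Proof.
rewrite half_blochE mxtrace2 !mulmx2 !mxE /= /dot; simpc.
by congr (_ +i* _); field.
Qed.

(** By the Pauli rule (v.sigma)(w.sigma) = v.w + i (v x w).sigma, the imaginary part is the triple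
    product. *)
Lemma tr_bloch3 s r t v p w :
  \tr ((2^-1 *: bloch s r) *m bloch t v *m bloch p w) =
  (s * t * p + s * dot v w + t * dot r w + p * dot r v) +i* dot r (cross v w).
Proof.
rewrite half_blochE mxtrace2 !mulmx2 !mxE /= /dot /cross /=; simpc.
by congr (_ +i* _); field.
Qed.

(** * The Holevo function and the three bounds of a fixed state *)

Section Model.
Variables (r : vec) (d : 'I_2 -> vec).
Let rho : 'M[C]_2 := 2^-1 *: bloch 1 r.
Let D i : 'M[C]_2 := 2^-1 *: bloch 0 (d i).

(** The scalar part is the one forced by tr(rho X) = 0. *)
Definition centered x : 'M[C]_2 := bloch (- dot r x) x.

Lemma tr_rho_centered x : \tr (rho *m centered x) = 0.
Proof. by rewrite tr_bloch2 mul1r addNr. Qed.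

Lemma tr_D_centered i x : \tr (D i *m centered x) = (dot (d i) x)%:C.
Proof. by rewrite tr_bloch2 mul0r add0r. Qed.

Lemma tr_rho_centered2 x y :
  \tr (rho *m centered x *m centered y) = cov r x y +i* dot r (cross x y).
Proof. by rewrite tr_bloch3 /cov; congr (_ +i* _); ring. Qed.

Lemma feasibleP (X : 'I_2 -> 'M[C]_2) :
  holevo_feasible rho D X <->
  exists x : 'I_2 -> vec, (forall i, X i = centered (x i)) /\
    (forall i j, dot (d i) (x j) = (i == j)%:R).
Proof.
split=> [[hX [hr hD]]|[x [hX hd]]].
  have {}hX i : exists x, X i = centered x.
    have [s [v e]] := hermitian_bloch (hX i); exists v.
    have := hr i; rewrite e tr_bloch2 mul1r => -[/eqP].
    by rewrite addr_eq0 => /eqP ->.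
  have [x ex] := choice hX; exists x; split=> // i j.
  have := hD i j; rewrite ex tr_D_centered.
  by case: (i == j) => -[].
split; first by move=> i; rewrite hX; exact: adj_bloch.
split=> [i|i j]; rewrite hX ?tr_rho_centered // tr_D_centered hd.
by rewrite rmorph_nat.
Qed.

Lemma Zmat_centered (x : 'I_2 -> vec) (X : 'I_2 -> 'M[C]_2) i j :
  (forall i, X i = centered (x i)) ->
  Zmat rho X i j = cov r (x i) (x j) +i* dot r (cross (x j) (x i)).
Proof. by move=> hX; rewrite mxE !hX tr_rho_centered2 covC. Qed.

Lemma Zmat_herm (x : 'I_2 -> vec) (X : 'I_2 -> 'M[C]_2) :
  (forall i, X i = centered (x i)) -> adj (Zmat rho X) = Zmat rho X.
Proof.
move=> hX; apply/matrixP => i j; rewrite mxE mxE !(Zmat_centered _ _ hX) /=.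
by rewrite covC; congr (_ +i* _); rewrite /dot /cross /=; ring.
Qed.

Variable W : 'M[R]_2.
Hypothesis hW : weight_matrix W.
Let w : R := Num.sqrt (\det W).
Let n := cross (d 0) (d 1).
Let q := cov_vec r n.
Let c := dot n q.
Let e : R := 1 - dot r r.
(** By [cross_dual] this is r . (x_0 x x_1) when both free coordinates vanish. Below, A / e turns
    out to be the SLD Fisher matrix, [base] is C^S and [k] is C^Z - C^R. *)
Let a : R := e * dot r n / c.
Let A i j : R := e * dot (d i) (d j) + dot r (d i) * dot r (d j).
Let base := (W 0 0 * A 1 1 - 2 * W 0 1 * A 0 1 + W 1 1 * A 0 0) / c.
Let pen := penalty (W 0 0) (W 0 1) (W 1 1) w (dot r (d 0)) (dot r (d 1)) c a.
Let k := wform (W 0 0) (W 0 1) (W 1 1) (dot r (d 1)) (- dot r (d 0)) / c.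

Hypothesis e_gt0 : 0 < e.
Hypothesis c_gt0 : 0 < c.

Let W00_gt0 : 0 < W 0 0. Proof. by have [] := weight_matrix_pos hW. Qed.
Let w_gt0 : 0 < w.
Proof. by rewrite sqrtr_gt0; have [] := weight_matrix_pos hW. Qed.
Let w_sqr : w ^+ 2 = \det W.
Proof. by rewrite sqr_sqrtr // ltW //; have [] := weight_matrix_pos hW. Qed.
Let W_sym : W^T = W. Proof. by case: hW. Qed.
Let e_neq0 : e != 0. Proof. by rewrite gt_eqF. Qed.
Let c_neq0 : c != 0. Proof. by rewrite gt_eqF. Qed.

Let bound2W Z := @bound2E R W Z w W_sym (ltW w_gt0) w_sqr.

Lemma holevo_fun_feasible (x : 'I_2 -> vec) (X : 'I_2 -> 'M[C]_2) :
  (forall i, X i = centered (x i)) ->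
  (forall i j, dot (d i) (x j) = (i == j)%:R) ->
  holevo_fun W rho X = base + pen (dot (x 0) q) (dot (x 1) q).
Proof.
move=> hX hd; rewrite /holevo_fun (bound2W (Zmat_herm hX)) !(Zmat_centered _ _ hX) /=.
have hx i j : dot (x j) (d i) = (i == j)%:R by rewrite dotC.
have cE i j := cov_dual r (d 0) (d 1) (x i) (x j).
rewrite -/n -/q -/c -/e in cE.
have c00 := cE 0 0; have c01 := cE 0 1; have c11 := cE 1 1.
rewrite !hx /= in c00 c01 c11.
have -> : dot r (cross (x 1) (x 0)) = - dot r (cross (x 0) (x 1)).
  by rewrite /dot /cross /=; ring.
rewrite normrN.
have := @cross_dual _ r (d 0) (d 1) (x 0) (x 1).
rewrite !hx => /(_ erefl erefl erefl erefl).
rewrite -/n -/q -/c -/e => cx.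
have {}cx : dot r (cross (x 0) (x 1)) =
  a - (dot (x 0) q * dot r (d 0) + dot (x 1) q * dot r (d 1)) / c.
  by apply: (mulfI c_neq0); rewrite cx /a; field.
have div (y z : R) : c * y = z -> y = z / c by move=> <-; field.
rewrite cx /pen /penalty addrA (div _ _ c00) (div _ _ c01) (div _ _ c11).
by congr (_ + _); rewrite /base /wform /A; field.
Qed.

Lemma feasible_exists T1 T2 : exists x : 'I_2 -> vec,
  (forall i j, dot (d i) (x j) = (i == j)%:R) /\
  dot (x 0) q = T1 /\ dot (x 1) q = T2.
Proof.
have [x [y [[x0 x1 xq] [y0 y1 yq]]]] := dual_exists c_gt0 T1 T2.
exists (fun j => if j == 0 then x else y); split=> //.
by elim/ord2P; elim/ord2P; rewrite /= dotC.
Qed.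

(** Feasible pairs realise every value of the two free coordinates, so minimising over them is
    minimising [penalty] over the plane. *)
Lemma holevo_bound_penalty :
  is_holevo_bound W rho D
    (base + penalty_min (W 0 0) (W 0 1) (W 1 1) w (dot r (d 0)) (dot r (d 1)) c a).
Proof.
have W10 : W 1 0 = W 0 1 by rewrite -[in LHS]W_sym mxE.
have w2 : w ^+ 2 = W 0 0 * W 1 1 - W 0 1 ^+ 2 by rewrite w_sqr det2 W10.
have [[T1 [T2 hT]] hmin] :=
  penalty_minP (dot r (d 0)) (dot r (d 1)) a W00_gt0 w_gt0 c_gt0 w2.
split.
  have [x [hd [x0 x1]]] := feasible_exists T1 T2.
  exists (fun i => centered (x i)); split; first by apply/feasibleP; exists x.
  by rewrite (@holevo_fun_feasible x) // x0 x1 /pen hT.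
move=> X /feasibleP[x [hX hd]].
by rewrite (holevo_fun_feasible hX hd) lerD2l hmin.
Qed.

Section SLD.
Variable l : 'I_2 -> vec.
Hypothesis hl : forall i y, dot (d i) y = cov r (l i) y.

Let L i := centered (l i).

(** The hypothesis [hl] says d_i = M l_i, so the covariance is d_i . M^-1 d_j with e M^-1 = e + r
    r^T. *)
Lemma cov_SLD i j : e * cov r (l i) (l j) = A i j.
Proof.
have h1 k' : e * dot r (l k') = dot r (d k').
  by rewrite (dotC r (d k')) hl /cov dotC /e; ring.
have h2 : dot (l i) (d j) = dot (d i) (d j) + dot r (l i) * dot r (d j).
  by rewrite (hl i) /cov; ring.
by rewrite covC -hl dotC h2 mulrDr mulrA h1.
Qed.

Lemma SLD_FisherE : SLD_Fisher rho L = \matrix_(i, j) (A i j / e)%:C.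
Proof.
apply/matrixP => i j; rewrite !mxE -scalemxAr mxtraceZ mulmxDr mxtraceD.
rewrite !mulmxA !tr_rho_centered2 (covC r (l j)).
rewrite half_real; simpc; congr (_ +i* _).
  by apply: (mulfI e_neq0); rewrite mulrCA mulrDr cov_SLD; field.
rewrite /dot /cross /=; ring.
Qed.

Let Ginv (i j : 'I_2) : R := (if i == 0 then (if j == 0 then A 1 1 else - A 0 1)
                     else (if j == 0 then - A 0 1 else A 0 0)) / c.

Lemma A10 : A 1 0 = A 0 1.
Proof. by rewrite /A (dotC (d 1)); ring. Qed.

Lemma A_det : A 0 0 * A 1 1 - A 0 1 ^+ 2 = e * c.
Proof. by have := dual_gram r (d 0) (d 1); rewrite -/n -/q -/c -/e /A => <-; ring. Qed.

Lemma GinvP i j : A i 0 / e * Ginv 0 j + A i 1 / e * Ginv 1 j = (i == j)%:R.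
Proof.
have det1 : (A 0 0 * A 1 1 - A 0 1 ^+ 2) / (e * c) = 1.
  by rewrite A_det divff // mulf_neq0.
move: i j; elim/ord2P; elim/ord2P; rewrite /Ginv /= ?A10 -?det1; field.
all: by rewrite c_neq0 e_neq0.
Qed.

Lemma invmx_SLD_Fisher : invmx (SLD_Fisher rho L) = \matrix_(i, j) (Ginv i j)%:C.
Proof.
apply: invmx_eq; rewrite SLD_FisherE; apply/matrixP => i j.
rewrite mulmx2 !mxE -!rmorphM -rmorphD /= GinvP.
by case: (i == j).
Qed.

Lemma CS_SLD : CS W rho L = base.
Proof.
have W10 : W 1 0 = W 0 1 by rewrite -[in LHS]W_sym mxE.
rewrite /CS invmx_SLD_Fisher mxtrace2 !mulmx2 !mxE -!rmorphM -!rmorphD /= W10.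
by rewrite /Ginv /base /=; field.
Qed.

(** The SLD duals form the feasible pair with both free coordinates zero, since l_i . q = l_i . M n
    = d_i . n = 0. *)
Lemma CZ_SLD : CZ W rho L = base + 2 * w * `|a|.
Proof.
pose x j := lincomb (Ginv 0 j) (l 0) (Ginv 1 j) (l 1).
have hX j : SLD_dual rho L j = centered (x j).
  rewrite /SLD_dual sum2 invmx_SLD_Fisher !mxE /L /centered !scale_bloch.
  have -> : dot r (x j) = Ginv 0 j * dot r (l 0) + Ginv 1 j * dot r (l 1).
    by rewrite dotC dot_lincomb !(dotC _ r).
  apply: eq_mx2; rewrite !mxE /=; simpc; congr (_ +i* _); rewrite /=; ring.
have dl i j : dot (d i) (l j) = A i j / e.
  by apply: (mulfI e_neq0); rewrite hl cov_SLD; field.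
have hd i j : dot (d i) (x j) = (i == j)%:R.
  by rewrite dotC dot_lincomb !(dotC _ (d i)) !dl -GinvP; ring.
have lq i : dot (l i) q = 0.
  rewrite dot_cov_vec -hl; move: i; apply: ord2P.
    exact: dot_crossl.
  exact: dot_crossr.
rewrite /CZ -/(holevo_fun _ _ _) (holevo_fun_feasible hX hd).
rewrite !dot_lincomb !lq !mulr0 addr0 /pen /penalty /wform.
by rewrite !(mul0r, mulr0, addr0, expr0n) subr0 add0r.
Qed.

End SLD.

Lemma RLD_FisherE (Lt : 'I_2 -> 'M[C]_2) :
  (forall i, is_RLD rho (D i) (Lt i)) ->
  RLD_Fisher rho Lt =
  \matrix_(i, j) ((dot (d i) (d j) / e) +i* (dot r (cross (d i) (d j)) / e)).
Proof.
(* (1 - r.sigma)(1 + r.sigma) = 1 - r.r, so reversing the Bloch vector inverts [rho] up to the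
   factor e / 2. *)
move=> hLt; pose r' : vec := (- r.1.1, - r.1.2, - r.2).
have rho_inv : bloch 1 r' *m rho = (e / 2)%:C%:M.
  by rewrite /rho half_blochE; apply: eq_mx2; rewrite mulmx2 !mxE /=; simpc;
    congr (_ +i* _); rewrite /e /dot; field.
have LtE i : Lt i = (e^-1)%:C *: (bloch 1 r' *m bloch 0 (d i)).
  have -> : bloch 0 (d i) = (2%:R)%:C *: D i.
    by rewrite /D half_real scalerA -rmorphM mulfV ?pnatr_eq0 // scale1r.
  rewrite -scalemxAr (hLt i) mulmxA rho_inv mul_scalar_mx !scalerA -!rmorphM /=.
  have e1 : e^-1 * (2 * (e / 2)) = 1 by field.
  by rewrite e1 scale1r.
apply/matrixP => i j; rewrite mxE -(hLt j) LtE adjoint_scale adjoint_mul !adj_bloch.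
rewrite -scalemxAr mxtraceZ mulmxA tr_bloch3 mxE; simpc.
congr (_ +i* _); rewrite /dot /cross /=; ring.
Qed.

Lemma CR_RLD (Lt : 'I_2 -> 'M[C]_2) :
  (forall i, is_RLD rho (D i) (Lt i)) ->
  CR W rho Lt = base + (2 * w * `|a| - k).
Proof.
move=> hLt; set t := dot r n.
have hc : c = dot (d 0) (d 0) * dot (d 1) (d 1) - dot (d 0) (d 1) ^+ 2 - t ^+ 2.
  exact: dual_norm.
(* Adjugate over determinant: by [hc] the RLD Fisher matrix has determinant c / e^2. Its real part
   lacks the terms (r.d_i)(r.d_j) of [A], and these account for [k]. *)
pose B : 'M[C]_2 := \matrix_(i, j)
  if i == 0 then if j == 0 then (e / c * dot (d 1) (d 1))%:C
    else (- (e / c * dot (d 0) (d 1))) +i* (- (e / c * t))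
  else if j == 0 then (- (e / c * dot (d 0) (d 1))) +i* (e / c * t)
    else (e / c * dot (d 0) (d 0))%:C.
have cr i : dot r (cross (d i) (d i)) = 0 by rewrite /dot /cross /=; ring.
have c10 : dot r (cross (d 1) (d 0)) = - t by rewrite /t /n /dot /cross /=; ring.
have rho_inv : RLD_Fisher rho Lt *m B = 1%:M.
  have det1 : (dot (d 0) (d 0) * dot (d 1) (d 1) - dot (d 0) (d 1) ^+ 2
               - t ^+ 2) / c = 1.
    by rewrite -hc divff.
  rewrite (RLD_FisherE hLt); apply: eq_mx2; rewrite mulmx2 !mxE /= ?cr ?c10 -/n -/t;
    rewrite ?(dotC (d 1) (d 0)); simpc; apply/eqP; rewrite eq_complex /=;
    apply/andP; split; apply/eqP; rewrite -?det1; field; by rewrite c_neq0 e_neq0.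
have BT : adj B = B by apply: eq_mx2; rewrite !mxE /= ?oppr0 ?opprK.
rewrite /CR (invmx_eq rho_inv) (bound2W BT) !mxE /= normrN.
rewrite -[e / c * t]mulrAC -/a /base /k /A /wform; field.
by [].
Qed.



Lemma holevo_bound_bloch (l : 'I_2 -> vec) (Lt : 'I_2 -> 'M[C]_2) :
  (forall i y, dot (d i) y = cov r (l i) y) ->
  (forall i, is_RLD rho (D i) (Lt i)) ->
  let cS := CS W rho (fun i => centered (l i)) in
  let cR := CR W rho Lt in
  let cZ := CZ W rho (fun i => centered (l i)) in
  let S := (2^-1 * (cZ + cS) - cR) ^+ 2 / (cZ - cR) in
  is_holevo_bound W rho D (if 2^-1 * (cZ + cS) <= cR then cR else cR + S) /\
  0 <= S.
Proof.
move=> hl hLt cS cR cZ S.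
pose u := w * `|a|.
have eS : cS = base by exact: CS_SLD.
have eZ : cZ = base + 2 * u by rewrite /cZ (CZ_SLD hl) /u mulrA.
have eR : cR = base + (2 * u - k) by rewrite /cR (CR_RLD hLt) /u mulrA.
have eZR : cZ - cR = k by rewrite eZ eR; ring.
have eH : 2^-1 * (cZ + cS) = base + 2^-1 * (2 * u) by rewrite eZ eS; field.
have eHR : 2^-1 * (cZ + cS) - cR = 2^-1 * (2 * u) - (2 * u - k) by rewrite eH eR; ring.
have W10 : W 1 0 = W 0 1 by rewrite -[in LHS]W_sym mxE.
have w2 : w ^+ 2 = W 0 0 * W 1 1 - W 0 1 ^+ 2 by rewrite w_sqr det2 W10.
have k_ge0 : 0 <= k.
  by rewrite divr_ge0 // ?(ltW c_gt0) //; exact: wform_ge0 W00_gt0 w2 _ _.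
(* This includes k = 0, where division by zero returns 0. *)
split; last by rewrite /S eZR divr_ge0 // sqr_ge0.
rewrite /S eHR eZR eH eR lerD2l.
have := holevo_bound_penalty; rewrite /penalty_min -/k -/u.
by case: (_ <= 2 * u - k); rewrite // addrA.
Qed.

End Model.

(** * From the hypotheses on the model to Bloch vectors *)

Lemma anticomm_bloch s v t w :
  (2^-1 *: bloch s v) *m bloch t w + bloch t w *m (2^-1 *: bloch s v) =
  bloch (s * t + dot v w) (lincomb s w t v).
Proof.
rewrite half_blochE; apply: eq_mx2; rewrite [LHS]mxE !mulmx2 !mxE /= /dot; simpc;
  by congr (_ +i* _); field.
Qed.

Lemma half_bloch_inj s v t w :
  2^-1 *: bloch s v = 2^-1 *: bloch t w -> s = t /\ v = w.
Proof.
move=> /(congr1 (fun M : 'M[C]_2 => 2 *: M)).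
rewrite !scalerA mulfV ?pnatr_eq0 // !scale1r.
exact: bloch_inj.
Qed.

(** The scalar part of the anticommutator equation centres L, and the vector part reads d = M l. *)
Lemma SLD_bloch (r d : vec) (L : 'M[C]_2) :
  is_SLD (2^-1 *: bloch 1 r) (2^-1 *: bloch 0 d) L ->
  exists l, L = centered r l /\ forall y, dot d y = cov r l y.
Proof.
move=> [/hermitian_bloch[s [l ->]]].
rewrite anticomm_bloch => /half_bloch_inj[+ ->].
rewrite mul1r => /esym/eqP; rewrite addr_eq0 => /eqP ->.
exists l; split=> // y; rewrite dot_lincomb /cov; ring.
Qed.

Lemma bloch_radius (r : vec) : Defs.posdef (2^-1 *: bloch 1 r) -> 0 < 1 - dot r r.
Proof.
move=> [_]; rewrite half_blochE => pos.
have {}pos (a b c : R) : (a != 0) || (c != 0) ->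
    0 < (1 + r.2) * (a ^+ 2 + b ^+ 2) + (1 - r.2) * c ^+ 2
        + 2 * c * (r.1.1 * a - r.1.2 * b).
  move=> abc; pose v : 'cV[C]_2 := \col_i (if i == 0 then a +i* b else c%:C).
  have v0 : v != 0.
    apply: contraL abc => /eqP /matrixP h; have := h 0 0; have := h 1 0.
    by rewrite !mxE /= => -[->] [-> _]; rewrite eqxx.
  have := pos v v0; rewrite -mulmxA !mxE sum2 !mxE !sum2 !mxE /=; simpc.
  by move=> /andP[_ h]; lra.
have p1 : 0 < 1 + r.2.
  by have := pos 1 0 0; rewrite oner_eq0 => /(_ isT); lra.
(* This vector makes the first entry of (1 + r.sigma) v vanish; the form there is (1 + r_3) (1 -
   r.r). *)
have := pos (- r.1.1) r.1.2 (1 + r.2); rewrite (gt_eqF p1) orbT => /(_ isT) h.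
rewrite -(pmulr_rgt0 _ p1) /dot; nra.
Qed.

Lemma cross_neq0 (D : 'I_2 -> 'M[C]_2) (d : 'I_2 -> vec) :
  (forall i, D i = 2^-1 *: bloch 0 (d i)) ->
  (forall a b : R, a%:C *: D 0 + b%:C *: D 1 = 0 -> a = 0 /\ b = 0) ->
  dot (cross (d 0) (d 1)) (cross (d 0) (d 1)) != 0.
Proof.
move=> hD hind; apply/eqP => /dot_eq0 n0.
(* The combination (d_1.d_1) d_0 - (d_0.d_1) d_1 equals d_1 x (d_0 x d_1), which vanishes with the
   cross product. *)
have [d11 _] : dot (d 1) (d 1) = 0 /\ - dot (d 0) (d 1) = 0.
  apply: hind; rewrite !hD !half_blochE !scale_bloch.
  case: n0; rewrite /dot /=.
  case: (d 0) => [[x1 x2] x3]; case: (d 1) => [[y1 y2] y3] /= n1 n2 n3.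
  have e1 : y2 * (x1 * y2 - x2 * y1) - y3 * (x3 * y1 - x1 * y3) = 0.
    by rewrite n2 n3; ring.
  have e2 : y3 * (x2 * y3 - x3 * y2) - y1 * (x1 * y2 - x2 * y1) = 0.
    by rewrite n1 n3; ring.
  have e3 : y1 * (x3 * y1 - x1 * y3) - y2 * (x2 * y3 - x3 * y2) = 0.
    by rewrite n1 n2; ring.
  apply: eq_mx2; rewrite !mxE /=; simpc; apply/eqP; rewrite eq_complex /=;
    apply/andP; split; apply/eqP; lra.
have [_ /eqP] : (0 : R) = 0 /\ (1 : R) = 0.
  apply: hind; rewrite !hD (dot_eq0 d11) half_blochE.
  rewrite !scale_bloch.
  apply: eq_mx2; rewrite !mxE /=; simpc; apply/eqP; rewrite eq_complex /=;
    apply/andP; split; apply/eqP; ring.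
by rewrite oner_eq0.
Qed.

End Qubit.

Lemma tr_drho_eq0 (R : realType) (Theta : set (R * R))
  (rho : R * R -> 'M[R[i]]_2) (theta : R * R) (i : 'I_2) :
  open Theta -> Theta theta ->
  (forall t, Theta t -> \tr (rho t) = 1) ->
  (forall j, differentiable (fun s => complex.Re (rho s j j)) theta) ->
  complex.Re (\tr (drho rho theta i)) = 0.
Proof.
move=> oT Tt tr1 df; set v := coord_dir R i.
pose f j := fun s => complex.Re (rho s j j).
have -> : complex.Re (\tr (drho rho theta i)) = 'D_v (f 0) theta + 'D_v (f 1) theta.
  by rewrite mxtrace2 !mxE.
rewrite -deriveD; [|exact/diff_derivable/df..].
(* The trace is known to be 1 only on [Theta]; openness makes that a neighbourhood of [theta], which
   suffices for the derivative. *)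
rewrite -(derive_cst (1 : R) theta v); apply: near_eq_derive.
near=> t; have Tht : Theta t by near: t; exact: open_nbhs_nbhs.
have := tr1 t Tht; rewrite mxtrace2 /= /f fctE.
by case: (rho t 0 0) => x y; case: (rho t 1 1) => x' y' [].
Unshelve. all: by end_near. Qed.

Unset Implicit Arguments.
Set Strict Implicit.

Theorem theorem1 (R : realType) (Theta : set (R * R))
  (rho : R * R -> 'M[R[i]]_2) (theta : R * R) (W : 'M[R]_2)
  (L Lt : 'I_2 -> 'M[R[i]]_2) :
  open Theta -> Theta theta ->
  (* each rho_t is a strictly positive (full-rank) density matrix *)
  (forall t, Theta t -> strictly_positive_density (rho t)) ->
  (* smoothness: every entry (real and imaginary part) is differentiable on Theta *)
  (forall t, Theta t -> forall j k : 'I_2,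
      differentiable (fun s => complex.Re (rho s j k)) t /\
      differentiable (fun s => complex.Im (rho s j k)) t) ->
  (* d_1 rho_theta, d_2 rho_theta are (real-)linearly independent *)
  (forall a b : R,
      (a%:C)%C *: drho rho theta ord0 + (b%:C)%C *: drho rho theta (lift ord0 ord0) = 0 ->
      a = 0 /\ b = 0) ->
  (* W is a real symmetric positive definite weight matrix *)
  weight_matrix W ->
  (* L i are the SLD operators, Lt i the RLD operators at theta *)
  (forall i, is_SLD (rho theta) (drho rho theta i) (L i)) ->
  (forall i, is_RLD (rho theta) (drho rho theta i) (Lt i)) ->
  let cS := CS W (rho theta) L in
  let cR := CR W (rho theta) Lt in
  let cZ := CZ W (rho theta) L in
  let S := ((2^-1 * (cZ + cS) - cR) ^+ 2) / (cZ - cR) in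
  is_holevo_bound W (rho theta) (drho rho theta)
    (if 2^-1 * (cZ + cS) <= cR then cR else cR + S) /\
  (~ (2^-1 * (cZ + cS) <= cR) -> 0 <= S).
Proof.

move=> oT Tt dens dfr indep hW hL hLt cS cR cZ S.
have [rho_pos rho_tr] := dens _ Tt.
have [s [r erho]] := hermitian_half_bloch (proj1 rho_pos).
have s1 : s = 1 by move: rho_tr; rewrite erho tr_half_bloch => -[].
rewrite {s}s1 in erho.
have dE i : exists d, drho rho theta i = 2^-1 *: bloch 0 d.
  (* Hermiticity is read off the SLD equation, as the anticommutator of two hermitian matrices is
     hermitian. *)
  have hD : Defs.hermitian (drho rho theta i).
    have [Lh ->] := hL i.
    rewrite /Defs.hermitian half_real adjoint_scale; congr (_ *: _).
    rewrite {1}/adj map_mxD linearD /= -!/(adj _) !adjoint_mul Lh (proj1 rho_pos).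
    by rewrite addrC.
  have [s [d eD]] := hermitian_half_bloch hD; exists d; rewrite eD.
  suff -> : s = 0 by [].
  have := @tr_drho_eq0 _ Theta rho theta i oT Tt (fun t Ht => proj2 (dens t Ht))
    (fun j => proj1 (dfr _ Tt j j)).
  by rewrite eD tr_half_bloch.
have [d ed] := choice dE.
have eD : drho rho theta = fun i => 2^-1 *: bloch 0 (d i) by apply: funext.
have lE i : exists l, L i = centered r l /\ forall y, dot (d i) y = cov r l y.
  by apply: SLD_bloch; rewrite -ed -erho.
have [l hl] := choice lE.
have eL : L = fun i => centered r (l i) by apply: funext => i; have [] := hl i.
have e_gt0 : 0 < 1 - dot r r by apply: bloch_radius; rewrite -erho.
have l01 : lift ord0 ord0 = 1 :> 'I_2 by exact: val_inj.
rewrite l01 in indep.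
have c_gt0 := dual_norm_gt0 e_gt0 (cross_neq0 ed indep).
have hl' i := proj2 (hl i).
rewrite eD erho in hLt.
have [H1 H2] := holevo_bound_bloch hW e_gt0 c_gt0 hl' hLt.
by rewrite /S /cS /cR /cZ eD erho eL; split.
Qed.
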